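(* Let $\zeta_1,\dots,\zeta_N$ be points in the unit disc $\mathbb{B}^2$ and consider the function $$H_N(z)=-\sum_{i=1}^N\log\frac{(1-|z|^2)(1-|\zeta_i|^2)}{|1-\bar z\zeta_i|^2},\qquad z\in\mathbb{B}^2.$$ Then: (1) The function $H_N$ has a unique global minimum on $\mathbb{B}^2$. (2) The minimum (point) of $H_N$ is the conformal barycenter of the points $\zeta_1,\dots,\zeta_N$.
   Context: $\mathbb{B}^2=\{z\in\mathbb{C}: |z|<1\}$ is the open unit disc. $N\ge 1$ is an integer. The conformal barycenter of points $\zeta_1,\dots,\zeta_N\in\mathbb{B}^2$ is the unique point $c\in\mathbb{B}^2$ such that $\sum_{k=1}^N \frac{c-\zeta_k}{1-\bar c\zeta_k}=0$. *)

(* Defs.v *)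
From mathcomp Require Import all_boot all_order all_algebra.
From mathcomp Require Import complex.
From mathcomp Require Import classical_sets reals exp.

Set Implicit Arguments.
Unset Strict Implicit.
Unset Printing Implicit Defensive.

Import Order.TTheory GRing.Theory Num.Theory.

Local Open Scope classical_set_scope.
Local Open Scope complex_scope.
Local Open Scope ring_scope.

(* [Normc.normc z] is the modulus as an element of R; the norm [`|z|] of R[i]
   is the same number seen in R[i], so it cannot be fed to [ln]. *)
Definition unit_disc (R : realType) : set R[i] :=
  [set z | Normc.normc z < 1].

Definition HN (R : realType) (N : nat) (zeta : 'I_N -> R[i]) (z : R[i]) : R :=
  - \sum_(i < N)
      ln ((1 - Normc.normc z ^+ 2) * (1 - Normc.normc (zeta i) ^+ 2)
          / Normc.normc (1 - z^*%C * zeta i) ^+ 2).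

Definition global_minimizer (R : realType) (D : set R[i]) (f : R[i] -> R)
    (c : R[i]) : Prop :=
  D c /\ forall z, D z -> f c <= f z.

Definition barycenter_equation (R : realType) (N : nat) (zeta : 'I_N -> R[i])
    (c : R[i]) : Prop :=
  \sum_(k < N) (c - zeta k) / (1 - c^*%C * zeta k) = 0.

(* [unique]: the equation has no other solution in the disc. *)
Definition conformal_barycenter (R : realType) (N : nat)
    (zeta : 'I_N -> R[i]) (c : R[i]) : Prop :=
  unique (fun w => @unit_disc R w /\ barycenter_equation zeta w) c.

(* Main.v *)
(** Moebius transformations of the disc preserve both [HN] and the barycenter
    equation, so any point [c] may be moved to the origin, where the equation
    reads [\sum_i a_i = 0]. There, along a ray of direction [e],
    [|1 - r e^* a| >= 1 - r x] with [x = Re (e^* a)], and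
    [2 ln (1 - r x) > (1 + x) ln (1 - r) + (1 - x) ln (1 + r)] by strict
    concavity of [ln]; summing cancels the terms linear in [x] and makes the
    origin a strict minimum. Conversely, [ln y <= y - 1] shows that a small step
    in the direction [\sum_i a_i] decreases [HN] unless the sum vanishes. Hence
    solutions of the equation and minimizers coincide and are unique. One exists
    because [exp (- HN)] extends continuously by [0] to the closed disc. *)
Require Import Defs.
From mathcomp Require Import all_boot all_order all_algebra.
From mathcomp Require Import complex ring lra.
From mathcomp Require Import boolp classical_sets reals exp.
From mathcomp Require Import topology normedtype derive function_spaces.

Set Implicit Arguments.
Unset Strict Implicit.
Unset Printing Implicit Defensive.

Import Order.TTheory GRing.Theory Num.Theory.
Import numFieldNormedType.Exports.

Local Open Scope classical_set_scope.
Local Open Scope ring_scope.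
Local Open Scope complex_scope.

(** * Moduli and Moebius maps of the disc *)

Section Disc.
Variable R : realType.
Implicit Types w z u a : R[i].

Local Notation normc := (@Normc.normc R).

Lemma normc_ge0 z : 0 <= normc z.
Proof. by case: z => x y; exact: sqrtr_ge0. Qed.

Lemma normc_gt0 z : (0 < normc z) = (z != 0).
Proof.
rewrite lt_def normc_ge0 andbT; apply/idP/idP; apply: contra => /eqP.
  by move=> ->; rewrite Normc.normc0.
by move/Normc.eq0_normc ->.
Qed.

Lemma normc_sqr z : normc z ^+ 2 = complex.Re z ^+ 2 + complex.Im z ^+ 2.
Proof. by case: z => x y /=; rewrite sqr_sqrtr// addr_ge0// sqr_ge0. Qed.

Lemma normc_conjc z : normc z^*%C = normc z.
Proof. by case: z => x y /=; rewrite sqrrN. Qed.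

Lemma unit_discE z : unit_disc z <-> normc z ^+ 2 < 1.
Proof. by rewrite /unit_disc/= expr_lt1// normc_ge0. Qed.

(** The product has modulus below 1. Only [z] needs to lie in the open disc: [w] on the unit circle
    occurs in the existence argument. *)
Lemma subr1_conjM_neq0 w z :
  normc w <= 1 -> normc z < 1 -> 1 - w^*%C * z != 0.
Proof.
move=> w1 z1; rewrite subr_eq0; apply/eqP => e.
have : normc (w^*%C * z) < 1.
  rewrite Normc.normcM normc_conjc; apply: le_lt_trans z1.
  by rewrite ler_piMl// normc_ge0.
by rewrite -e Normc.normc1 ltxx.
Qed.

(* [^*%C] is [conjc], as in [HN]; a bare [^*] would be parsed as [Num.conj]. *)
Definition mobius w z : R[i] := (z - w) / (1 - w^*%C * z).

(** Clearing denominators leaves the polynomial identity [|1 - w^* z|^2 - |z - w|^2 = (1 - |w|^2)(1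
    - |z|^2)], checked in real coordinates. *)
Lemma normc_mobius w z : unit_disc w -> unit_disc z ->
  1 - normc (mobius w z) ^+ 2 =
  (1 - normc w ^+ 2) * (1 - normc z ^+ 2) / normc (1 - w^*%C * z) ^+ 2.
Proof.
move=> dw dz; have nz := subr1_conjM_neq0 (ltW dw) dz.
have nz' : normc (1 - w^*%C * z) != 0 by rewrite gt_eqF// normc_gt0.
rewrite /mobius Normc.normcM Normc.normcV exprMn exprVn.
apply: (mulIf (expf_neq0 2 nz')); rewrite mulrBl !mulfVK ?expf_neq0//.
by case: w z {dw dz nz nz'} => [a b] [c d]; rewrite !normc_sqr /=; ring.
Qed.

Lemma mobius_disc w z : unit_disc w -> unit_disc z -> unit_disc (mobius w z).
Proof.
move=> dw dz; apply/unit_discE; rewrite -subr_gt0 normc_mobius//.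
apply: divr_gt0; first by apply: mulr_gt0; rewrite subr_gt0; exact/unit_discE.
by rewrite exprn_gt0// normc_gt0 subr1_conjM_neq0// ltW.
Qed.

Lemma mobius_self w : mobius w w = 0.
Proof. by rewrite /mobius subrr mul0r. Qed.

Lemma mobius_eq0 w z : unit_disc w -> unit_disc z -> mobius w z = 0 -> z = w.
Proof.
move=> dw dz /eqP; rewrite mulf_eq0 invr_eq0.
by rewrite (negbTE (subr1_conjM_neq0 (ltW dw) dz)) orbF subr_eq0 => /eqP.
Qed.

Lemma unit_disc_opp z : unit_disc z -> unit_disc (- z).
Proof. by rewrite !unit_discE !normc_sqr; case: z => x y /=; rewrite !sqrrN. Qed.

Lemma mobiusK w z : unit_disc w -> unit_disc z -> mobius (- w) (mobius w z) = z.
Proof.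
move=> dw dz; have nz := subr1_conjM_neq0 (ltW dw) dz.
have nz1 := subr1_conjM_neq0 (ltW (unit_disc_opp dw)) (mobius_disc dw dz).
have nw := subr1_conjM_neq0 (ltW dw) dw.
move: nz1; rewrite /mobius rmorphN/= => nz1.
apply: (mulIf nz1); rewrite mulfVK//.
by field.
Qed.

(** * Invariance under Moebius maps *)

Lemma conj_mobius w z : (mobius w z)^*%C = (z^*%C - w^*%C) / (1 - w * z^*%C).
Proof. by rewrite /mobius fmorph_div !rmorphB rmorphM rmorph1/= conjcK. Qed.

(** The kernel picks up one factor in [w, z] and one in [w, a]; in [invariant_ratio] their moduli
    cancel against those from [normc_mobius]. *)
Lemma mobius_kernel w z a : unit_disc w -> unit_disc z -> unit_disc a ->
  1 - (mobius w z)^*%C * mobius w a =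
  (1 - w^*%C * w) * (1 - z^*%C * a) / ((1 - z^*%C * w) * (1 - w^*%C * a)).
Proof.
move=> dw dz da.
have n1 := subr1_conjM_neq0 (ltW dw) da; have n2 := subr1_conjM_neq0 (ltW dz) dw.
rewrite conj_mobius /mobius [w * z^*%C]mulrC; field.
by rewrite n1 n2.
Qed.

Lemma normc_one_sub_conjM w : unit_disc w ->
  normc (1 - w^*%C * w) = 1 - normc w ^+ 2.
Proof.
move=> /unit_discE dw; rewrite -[RHS]ger0_norm; last by rewrite subr_ge0 ltW.
rewrite -sqrtr_sqr normc_sqr.
by case: w {dw} => x y /=; congr Num.sqrt; ring.
Qed.

(** On the disc this is [1 - |mobius z a|^2], a function of the hyperbolic distance from [z] to
    [a]. *)
Definition invariant_ratio z a : R :=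
  (1 - normc z ^+ 2) * (1 - normc a ^+ 2) / normc (1 - z^*%C * a) ^+ 2.

Lemma invariant_ratio_gt0 z a : unit_disc z -> unit_disc a ->
  0 < invariant_ratio z a.
Proof.
move=> dz da; apply: divr_gt0.
  by apply: mulr_gt0; rewrite subr_gt0; exact/unit_discE.
by rewrite exprn_gt0// normc_gt0 subr1_conjM_neq0// ltW.
Qed.

Lemma invariant_ratio_mobius w z a : unit_disc w -> unit_disc z -> unit_disc a ->
  invariant_ratio (mobius w z) (mobius w a) = invariant_ratio z a.
Proof.
move=> dw dz da; rewrite /invariant_ratio !normc_mobius// mobius_kernel//.
rewrite !(Normc.normcM, Normc.normcV) normc_one_sub_conjM//.
have -> : normc (1 - z^*%C * w) = normc (1 - w^*%C * z).
  by rewrite -normc_conjc rmorphB rmorphM rmorph1/= conjcK mulrC.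
have nz : normc (1 - w^*%C * z) != 0 by rewrite gt_eqF// normc_gt0 subr1_conjM_neq0// ltW.
have na : normc (1 - w^*%C * a) != 0 by rewrite gt_eqF// normc_gt0 subr1_conjM_neq0// ltW.
have nza : normc (1 - z^*%C * a) != 0 by rewrite gt_eqF// normc_gt0 subr1_conjM_neq0// ltW.
have nw : 1 - normc w ^+ 2 != 0 by rewrite gt_eqF// subr_gt0; exact/unit_discE.
by field; rewrite nz na nza nw.
Qed.

Lemma HN_mobius N (zeta : 'I_N -> R[i]) w z :
  (forall i, unit_disc (zeta i)) -> unit_disc w -> unit_disc z ->
  HN (fun i => mobius w (zeta i)) (mobius w z) = HN zeta z.
Proof.
move=> dzeta dw dz; congr (- _); apply: eq_bigr => i _; congr ln.
exact: invariant_ratio_mobius.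
Qed.

Lemma barycenter_equation_mobius N (zeta : 'I_N -> R[i]) w :
  barycenter_equation zeta w <-> \sum_i mobius w (zeta i) = 0.
Proof.
rewrite /barycenter_equation.
have -> : \sum_(k < N) (w - zeta k) / (1 - w^*%C * zeta k)
  = - \sum_i mobius w (zeta i).
  by rewrite -sumrN; apply: eq_bigr => i _; rewrite -[w - _]opprB mulNr.
by split=> /eqP; rewrite ?oppr_eq0 => /eqP // ->; rewrite oppr0.
Qed.

(** * Inequalities for the logarithm *)

Lemma lt_ln_sub1 (x : R) : 0 < x -> x != 1 -> ln x < x - 1.
Proof.
move=> x0 x1; rewrite ltrBrDl -[ltRHS]lnK ?posrE//.
by rewrite expR_gt1Dx// ln_eq0.
Qed.

Lemma le_ln_sub1 (x : R) : 0 < x -> ln x <= x - 1.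
Proof. by move=> x0; rewrite -[in leLHS](subrK 1 x) addrC le_ln1Dx// ltrBrDl addrN. Qed.

(* [1 - p] is a weighted mean of [1 - r] and [1 + r], so this is strict
   concavity of [ln]. *)
Lemma ln_chord (r p : R) : 0 < r < 1 -> `|p| < r ->
  (r + p) * ln (1 - r) + (r - p) * ln (1 + r) < r * ln ((1 - p) ^+ 2).
Proof.
move=> /andP[r0 r1]; rewrite ltr_norml => /andP[pr1 pr2].
have p1 : 0 < 1 - p by lra.
(* The graph of [ln] lies strictly below its tangent at [1 - p], away from the point of contact. *)
have ratio b : 0 < b -> b != 1 - p -> ln b < ln (1 - p) + (b - (1 - p)) / (1 - p).
  move=> b0 bp; rewrite -ltrBlDl -ln_div ?posrE// mulrBl divff ?gt_eqF//.
  apply: lt_ln_sub1; first exact: divr_gt0.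
  by apply: contra bp => /eqP e; rewrite -[b](mulfVK (lt0r_neq0 p1)) e mul1r.
have h1 := ratio (1 - r); have h2 := ratio (1 + r).
have {}h1 : ln (1 - r) < ln (1 - p) + (p - r) / (1 - p).
  have -> : p - r = (1 - r) - (1 - p) by ring.
  by apply: h1; [lra|apply/eqP; lra].
have {}h2 : ln (1 + r) < ln (1 - p) + (p + r) / (1 - p).
  have -> : p + r = (1 + r) - (1 - p) by ring.
  by apply: h2; [lra|apply/eqP; lra].
rewrite lnXn// -subr_gt0.
rewrite -(ltr_pM2l (x := r + p)) in h1; last lra.
rewrite -(ltr_pM2l (x := r - p)) in h2; last lra.
(* With weights [r + p] and [r - p] the two tangent corrections cancel, since [1 - p] is the
   weighted mean. *)
have e : (r + p) * ((p - r) / (1 - p)) + (r - p) * ((p + r) / (1 - p)) = 0 by field; rewrite gt_eqF.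
rewrite mulrDr in h1; rewrite mulrDr in h2.
rewrite mulr2n; nra.
Qed.

(** * Comparison of [HN] with its value at the origin *)

Lemma HN_sub0 N (zeta : 'I_N -> R[i]) u :
  (forall i, unit_disc (zeta i)) -> unit_disc u ->
  HN zeta u - HN zeta 0 =
  \sum_i (ln (normc (1 - u^*%C * zeta i) ^+ 2) - ln (1 - normc u ^+ 2)).
Proof.
move=> dzeta du; rewrite /HN opprK addrC -sumrB; apply: eq_bigr => i _.
have da : 0 < 1 - normc (zeta i) ^+ 2 by rewrite subr_gt0; exact/unit_discE.
have du' : 0 < 1 - normc u ^+ 2 by rewrite subr_gt0; exact/unit_discE.
have k0 : 0 < normc (1 - u^*%C * zeta i) ^+ 2.
  by rewrite exprn_gt0// normc_gt0 subr1_conjM_neq0 ?ltW//; exact: dzeta.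
rewrite rmorph0 mul0r subr0 Normc.normc0 Normc.normc1 expr0n expr1n/= subr0 mul1r divr1.
rewrite ln_div ?posrE// ?mulr_gt0// lnM ?posrE//; ring.
Qed.

Lemma unit_disc0 : unit_disc (0 : R[i]).
Proof. by apply/unit_discE; rewrite normc_sqr /= expr0n addr0 ltr01. Qed.

Lemma Re_sum I (s : seq I) (P : pred I) (F : I -> R[i]) :
  complex.Re (\sum_(i <- s | P i) F i) = \sum_(i <- s | P i) complex.Re (F i).
Proof. by apply: (big_morph (@complex.Re R)) => // -[a b] [c d]. Qed.

Lemma ge_Re_normc z : `|complex.Re z| <= normc z.
Proof.
rewrite -(ler_pXn2r (ltn0Sn 1)) ?nnegrE ?normr_ge0 ?normc_ge0//.
by rewrite real_normK ?num_real// normc_sqr lerDl sqr_ge0.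
Qed.

Lemma HN_lt_of_sum0 N (zeta : 'I_N -> R[i]) u : (0 < N)%N ->
  (forall i, unit_disc (zeta i)) -> \sum_i zeta i = 0 ->
  unit_disc u -> u != 0 -> HN zeta 0 < HN zeta u.
Proof.
move=> N0 dzeta S0 du u0; rewrite -subr_gt0 HN_sub0//.
have r0 : 0 < normc u by rewrite normc_gt0.
have r1 : normc u < 1 by [].
set r := normc u in r0 r1 *.
pose p i := complex.Re (u^*%C * zeta i).
have sump : \sum_i p i = 0.
  by rewrite -Re_sum -mulr_sumr S0 mulr0.
rewrite -(pmulr_rgt0 _ r0) mulr_sumr.
(* As the [p i] sum to 0, zero may be written so that the claim holds term by term: each term is
   [ln_chord] with [r * ln (1 - r ^+ 2)] subtracted from both sides. *)
rewrite [ltLHS](_ : 0 = \sum_i p i * (ln (1 - r) - ln (1 + r))); last by rewrite -mulr_suml sump mul0r.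
apply: ltr_sum.
  by apply/hasP; exists (Ordinal N0); rewrite ?mem_index_enum.
move=> i _.
have pr : `|p i| < r.
  apply: le_lt_trans (ge_Re_normc _) _.
  rewrite Normc.normcM normc_conjc -[ltRHS]mulr1 ltr_pM2l//; exact: dzeta.
have p1 : 0 < 1 - p i by move: pr; rewrite ltr_norml => /andP[]; lra.
have : ln ((1 - p i) ^+ 2) <= ln (normc (1 - u^*%C * zeta i) ^+ 2).
  have h : (1 - p i) ^+ 2 <= normc (1 - u^*%C * zeta i) ^+ 2.
    rewrite normc_sqr /p; case: (_ * _) => x y /=.
    by rewrite lerDl sqr_ge0.
  have hp : 0 < (1 - p i) ^+ 2 by rewrite exprn_gt0.
  by rewrite ler_ln ?posrE// (lt_le_trans hp h).
rewrite -(ler_pM2l r0) => h.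
have := ln_chord (r := r) (p := p i); rewrite r0 r1 => /(_ isT pr) h2.
have -> : ln (1 - r ^+ 2) = ln (1 - r) + ln (1 + r).
  by rewrite -lnM ?posrE ?subr_gt0 ?addr_gt0 ?ltr01//; congr ln; ring.
by rewrite mulrBr; lra.
Qed.

Lemma sum0_of_HN_min N (zeta : 'I_N -> R[i]) : (0 < N)%N ->
  (forall i, unit_disc (zeta i)) ->
  (forall u, unit_disc u -> HN zeta 0 <= HN zeta u) -> \sum_i zeta i = 0.
Proof.
move=> N0 dzeta min0; set S := \sum_i zeta i; pose s := normc S ^+ 2.
have s0 : 0 <= s by rewrite exprn_ge0// normc_ge0.
have N1 : 1 <= N%:R :> R by rewrite ler1n.
(* This choice bounds [e * s], [e * N] and, as [N >= 1], [e] itself by 1/2. *)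
pose e := (2 * (N%:R + s))^-1.
have e0 : 0 < e by rewrite invr_gt0; lra.
have eE : e * (2 * (N%:R + s)) = 1 by rewrite mulVf//; apply/eqP; lra.
have es : e * s <= 1 / 2 by nra.
have eN : e * N%:R <= 1 / 2 by nra.
have e1 : e <= 1 / 2 by nra.
(* The step [e S] stays in the disc, and [e] is small enough for the linear term to dominate. *)
pose u := e%:C * S.
have nu : normc u ^+ 2 = e ^+ 2 * s.
  by rewrite /u Normc.normcM exprMn [X in X * _]normc_sqr/= expr0n addr0.
have nu1 : e ^+ 2 * s <= 1 / 2 by nra.
have du : unit_disc u by apply/unit_discE; rewrite nu; lra.
pose p i := complex.Re (u^*%C * zeta i).
have sump : \sum_i p i = e * s.
  rewrite -Re_sum -mulr_sumr -/S /u /s normc_sqr.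
  by case: (S) => x y /=; ring.
(* Of the coefficient 3, one unit bounds the quadratic term of the kernel, as [|zeta i| < 1], and
   two bound [- ln (1 - e ^+ 2 * s)], as [e ^+ 2 * s <= 1/2]. *)
have : 0 <= \sum_i (- (2 * p i) + 3 * (e ^+ 2 * s)).
  have h := min0 u du; rewrite -subr_ge0 HN_sub0// in h.
  apply: le_trans h _; apply: ler_sum => i _.
  have k0 : 0 < normc (1 - u^*%C * zeta i) ^+ 2.
    by rewrite exprn_gt0// normc_gt0 subr1_conjM_neq0 ?ltW//; exact: dzeta.
  have kE : normc (1 - u^*%C * zeta i) ^+ 2 =
      1 - 2 * p i + normc u ^+ 2 * normc (zeta i) ^+ 2.
    rewrite -exprMn -[normc u]normc_conjc -Normc.normcM !normc_sqr /p.
    by case: (_ * _) => x y /=; ring.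
  have da : normc (zeta i) ^+ 2 < 1 by apply/unit_discE.
  have := le_ln_sub1 k0; rewrite kE nu => h1.
  have r1 : 0 < 1 - e ^+ 2 * s by lra.
  have := le_ln_sub1 (x := (1 - e ^+ 2 * s)^-1); rewrite invr_gt0 => /(_ r1).
  rewrite lnV ?posrE// => h2.
  have q0 : 0 <= e ^+ 2 * s by rewrite mulr_ge0// sqr_ge0.
  have h3 : (1 - e ^+ 2 * s)^-1 - 1 <= 2 * (e ^+ 2 * s).
    have -> : (1 - e ^+ 2 * s)^-1 - 1 = (e ^+ 2 * s) / (1 - e ^+ 2 * s).
      by field; rewrite gt_eqF.
    by rewrite ler_pdivrMr//; nra.
  have h4 : e ^+ 2 * s * normc (zeta i) ^+ 2 <= e ^+ 2 * s by rewrite ler_piMr// ltW.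
  lra.
rewrite big_split/= sumrN -mulr_sumr sump sumr_const card_ord -mulr_natl => h.
have s_le0 : s <= 0.
  (* The bracket is at most [- 2 + 3/2 < 0], which forces [e * s <= 0]. *)
  have h2 : 0 <= e * s * (- 2 + 3 * (e * N%:R)) by move: h; nra.
  have h3 : e * s <= 0 by nra.
  by rewrite -(ler_pM2l e0) mulr0.
apply: (@Normc.eq0_normc R); apply/eqP.
by rewrite -[_ == 0]sqrf_eq0 eq_le s_le0.
Qed.

End Disc.

(** * Existence of a minimizer by compactness *)

Lemma ln_prod (R : realType) (I : Type) (s : seq I) (F : I -> R) :
  (forall i, 0 < F i) -> ln (\prod_(i <- s) F i) = \sum_(i <- s) ln (F i).
Proof.
move=> F0; elim: s => [|i s IH]; first by rewrite !big_nil ln1.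
by rewrite !big_cons lnM ?posrE ?prodr_gt0// IH.
Qed.

Section Existence.
Variables (R : realType) (N : nat) (zeta : 'I_N -> R[i]).
Hypotheses (N_gt0 : (0 < N)%N) (dzeta : forall i, unit_disc (zeta i)).

(** Real coordinates give compactness as a closed subset of the square [[-1, 1]^2]. *)
Let closed_disc : set (R * R) := [set v | v.1 ^+ 2 + v.2 ^+ 2 <= 1].

(** This is [exp (- HN)] on the open disc, extended by the same formula to the unit circle, where
    the factor [1 - |z|^2] makes it vanish. *)
Let ratio_prod (v : R * R) : R :=
  \prod_i invariant_ratio (v.1 +i* v.2) (zeta i).

Let closed_discE v : closed_disc v <-> Normc.normc (v.1 +i* v.2) <= 1.
Proof.
by rewrite -(@ler_pXn2r _ 2)// ?nnegrE ?normc_ge0// normc_sqr expr1n.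
Qed.

Let sqnorm_continuous : continuous (fun v : R * R => v.1 ^+ 2 + v.2 ^+ 2).
Proof.
move=> v; apply: cvgD; rewrite expr2; apply: cvgM;
  by [exact: cvg_fst|exact: cvg_snd].
Qed.

Let closed_disc_compact : compact closed_disc.
Proof.
apply: (subclosed_compact _ (compact_setX (@segment_compact R (- 1) 1)
  (@segment_compact R (- 1) 1))).
  have -> : closed_disc = ((fun v => v.1 ^+ 2 + v.2 ^+ 2) @^-1` [set x | x <= 1]) by [].
  by apply: closed_comp => [v _|]; [exact: sqnorm_continuous|exact: closed_le].
move=> -[x y] /=; rewrite /closed_disc/= => h; rewrite !in_itv/=.
by split; apply/andP; split; nra.
Qed.

Let ratio_prod_continuous : {within closed_disc, continuous ratio_prod}.
Proof.
apply: continuous_in_subspaceT => v; rewrite inE => /closed_discE dv.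
apply: cvg_big => [|i _]; first exact: mul_continuous.
rewrite /invariant_ratio; under eq_cvg do rewrite normc_sqr/=.
apply: cvgM; first apply: cvgM; first apply: cvgB.
- exact: cvg_cst.
- rewrite normc_sqr/=; exact: sqnorm_continuous.
- exact: cvg_cst.
apply: cvgV.
  by rewrite sqrf_eq0 gt_eqF// normc_gt0 subr1_conjM_neq0//; exact: dzeta.
(* The squared modulus of the kernel as a polynomial in the real coordinates. *)
pose g (v : R * R) :=
  (1 - (v.1 * complex.Re (zeta i) + v.2 * complex.Im (zeta i))) ^+ 2 +
  (v.1 * complex.Im (zeta i) - v.2 * complex.Re (zeta i)) ^+ 2.
have gE (w : R * R) : Normc.normc (1 - (w.1 +i* w.2)^*%C * zeta i) ^+ 2 = g w.
  by rewrite normc_sqr /g; case: (zeta i) => a b /=; ring.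
rewrite (funext gE) gE /g.
have lin (a b : R) : w.1 * a + w.2 * b @[w --> v] --> v.1 * a + v.2 * b.
  by apply: cvgD; apply: cvgM; (exact: cvg_cst || exact: cvg_fst || exact: cvg_snd).
have cf (a b : R) : w.1 * a - w.2 * b @[w --> v] --> v.1 * a - v.2 * b.
  by apply: cvgB; apply: cvgM; (exact: cvg_cst || exact: cvg_fst || exact: cvg_snd).
have c1 : 1 - (w.1 * complex.Re (zeta i) + w.2 * complex.Im (zeta i)) @[w --> v]
    --> 1 - (v.1 * complex.Re (zeta i) + v.2 * complex.Im (zeta i)).
  by apply: cvgB; [exact: cvg_cst|exact: lin].
by rewrite !expr2; under eq_fun do rewrite !expr2; apply: cvgD; apply: cvgM; (exact: c1 || exact: cf).
Qed.

Let ln_ratio_prod z : unit_disc z ->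
  0 < ratio_prod (complex.Re z, complex.Im z) /\
  HN zeta z = - ln (ratio_prod (complex.Re z, complex.Im z)).
Proof.
case: z => x y dz.
have q0 i : 0 < invariant_ratio (x +i* y) (zeta i) by exact: invariant_ratio_gt0.
by rewrite /HN -ln_prod//; split=> //; exact: prodr_gt0.
Qed.

Lemma HN_minimizer_exists : exists c, global_minimizer (@unit_disc R) (HN zeta) c.
Proof.
have [|[x y] /set_mem dc cmax] :=
  compact_EVT_max _ closed_disc_compact ratio_prod_continuous.
  by exists (0, 0); rewrite /closed_disc/= expr0n addr0 ler01.
(* The value at the origin is positive, so the maximum is too; this keeps the maximizer off the unit
   circle. *)
have [P0 _] := ln_ratio_prod (unit_disc0 R).
have Pc : 0 < ratio_prod (x, y).
  apply: lt_le_trans P0 (cmax _ _).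
  by rewrite inE /closed_disc/= expr0n addr0 ler01.
have dc' : unit_disc (x +i* y).
  move/closed_discE: dc => dc; rewrite /unit_disc /mkset lt_neqAle dc andbT.
  apply/eqP => n1; move: Pc; rewrite /ratio_prod (bigD1 (Ordinal N_gt0))//=.
  by rewrite [invariant_ratio _ _]/invariant_ratio n1 expr1n subrr !mul0r ltxx.
exists (x +i* y); split=> // z dz.
have [_ ->] := ln_ratio_prod dc'; have [Pz ->] := ln_ratio_prod dz.
rewrite lerN2 ler_ln ?posrE//; apply: cmax; rewrite inE.
by apply/closed_discE; case: z {Pz} dz => a b dz; apply: ltW.
Qed.

End Existence.

(** * Transport from the origin to any point of the disc *)

Lemma global_minimizer_barycenter (R : realType) N (zeta : 'I_N -> R[i]) c :
  (0 < N)%N -> (forall i, unit_disc (zeta i)) ->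
  global_minimizer (@unit_disc R) (HN zeta) c -> barycenter_equation zeta c.
Proof.
move=> N0 dzeta [dc cmin]; apply/barycenter_equation_mobius.
apply: sum0_of_HN_min => // [i|u du]; first exact: mobius_disc.
have dmu : unit_disc (mobius (- c) u) by apply: mobius_disc => //; exact: unit_disc_opp.
(* Every [u] in the disc is the image under [mobius c] of a point of the disc, so minimality at [c]
   becomes minimality at the origin for the moved points. *)
have -> : u = mobius c (mobius (- c) u).
  by rewrite -{1}[c]opprK mobiusK//; exact: unit_disc_opp.
by rewrite -(mobius_self c) !HN_mobius//; exact: cmin.
Qed.

Lemma HN_barycenter_lt (R : realType) N (zeta : 'I_N -> R[i]) c z :
  (0 < N)%N -> (forall i, unit_disc (zeta i)) -> unit_disc c ->
  barycenter_equation zeta c -> unit_disc z -> z != c -> HN zeta c < HN zeta z.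
Proof.
move=> N0 dzeta dc /barycenter_equation_mobius S0 dz zc.
rewrite -(HN_mobius dzeta dc dc) -(HN_mobius dzeta dc dz) mobius_self.
apply: HN_lt_of_sum0 => // [i||]; [exact: mobius_disc..|].
by apply: contra zc => /eqP /(mobius_eq0 dc dz) ->.
Qed.

Theorem theorem1p6 (R : realType) (N : nat) (zeta : 'I_N -> complex R)
    (N_ge1 : (1 <= N)%N)
    (zeta_disc : forall i : 'I_N, @unit_disc R (zeta i)) :
  (exists! c : complex R, global_minimizer (@unit_disc R) (HN zeta) c) /\
  (forall c : complex R, global_minimizer (@unit_disc R) (HN zeta) c ->
     conformal_barycenter zeta c).
Proof.
(* A minimizer solves the equation, hence is a strict minimum. This gives both uniqueness claims:
   for minimizers and for solutions. *)
have uniq c z : global_minimizer (@unit_disc R) (HN zeta) c ->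
    unit_disc z -> HN zeta z <= HN zeta c -> c = z.
  move=> cmin dz zc; apply/eqP; rewrite eq_sym; apply: contraLR zc => zc.
  rewrite -ltNge; apply: HN_barycenter_lt => //; first by case: cmin.
  exact: global_minimizer_barycenter.
split.
  have [c cmin] := HN_minimizer_exists N_ge1 zeta_disc.
  by exists c; split=> // z [dz zmin]; apply: uniq => //; apply: zmin; case: cmin.
move=> c cmin; have [dc cle] := cmin; split.
  by split=> //; exact: global_minimizer_barycenter.
(* A solution [w] other than [c] would be a strict minimum itself, so in every case
   [HN zeta w <= HN zeta c]. *)
move=> w [dw wbar]; apply: uniq => //; have [->//|cw] := eqVneq c w.
exact/ltW/HN_barycenter_lt.
Qed.
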